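(* Let $n\ge 1$ and let $X$ be a finite pure $n$-dimensional simplicial complex with connected links. Assume that $X$ is $(n+1)$-partite with sides $S_0,\dots,S_n$, and partite-regular in the following sense: for every $0\le i\le n$ there is a constant $K_i$ such that every vertex $\{v\}$ with $v\in S_i$ is contained in exactly $K_i$ $n$-dimensional simplices of $X$. Assume that there is a constant $0<\lambda<1$ such that for every $\tau\in X(n-2)$ the spectrum of the simple random walk on the graph $X_\tau$ is contained in $\left[-1,\frac{\lambda}{1+(n-1)\lambda}\right]\cup\{1\}$. Then for all sets $U_0\subseteq S_0,\dots,U_n\subseteq S_n$, $$\left|\frac{|X(U_0,\dots,U_n)|}{|X(n)|}-\frac{|U_0|\cdots|U_n|}{|S_0|\cdots|S_n|}\right|\le C_n\lambda\min_{0\le i<j\le n}\sqrt{\frac{|U_i||U_j|}{|S_i||S_j|}},$$ where $$C_n=\sum_{k=0}^{n-1}n!\,\frac{(n+1-k)^{n-k}}{(n-k-1)!}\left((k+1)(k+2)^{n-k}-(k+1)^{n-k+1}\right).$$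
   Context: $X(k)$ denotes the set of simplices of $X$ with $k+1$ vertices, $X(-1)=\{\emptyset\}$; a vertex $v$ is identified with $\{v\}\in X(0)$. $X$ is pure $n$-dimensional if every simplex is contained in a simplex of $X(n)$. For $\tau\in X(k)$ the link $X_\tau$ is the complex with $\eta\in X_\tau(l)$ iff $\eta\in X(l)$ and $\tau\cup\eta\in X(k+l+1)$; $X_\emptyset=X$. ''Connected links'' means that for every $-1\le k\le n-2$ and every $\tau\in X(k)$ the one-skeleton of $X_\tau$ (the graph with vertices $X_\tau(0)$ and edges $X_\tau(1)$) is connected; in particular the one-skeleton of $X$ is connected. $X$ is $(n+1)$-partite with sides $S_0,\dots,S_n\subseteq X(0)$ if the $S_i$ are disjoint, $X(0)=\bigcup_i S_i$, and $|\sigma\cap S_i|=1$ for every $\sigma\in X(n)$ and every $0\le i\le n$. For $\tau\in X(n-2)$, $X_\tau$ is a graph; the simple random walk operator on it sends $\phi:X_\tau(0)\to\mathbb{R}$ to the function $v\mapsto\frac{1}{\deg(v)}\sum_{u:\{u,v\}\in X_\tau(1)}\phi(u)$. For pairwise disjoint $U_0,\dots,U_n\subseteq X(0)$, $X(U_0,\dots,U_n)=\{\sigma\in X(n):|\sigma\cap U_i|=1\text{ for all }0\le i\le n\}$. *)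

(* Defs.v *)
From HB Require Import structures.
From mathcomp Require Import all_boot all_order all_algebra.
From mathcomp Require Import reals.

Set Implicit Arguments.
Unset Strict Implicit.
Unset Printing Implicit Defensive.

Import Order.TTheory GRing.Theory Num.Theory.
Local Open Scope ring_scope.

Section Complexes.
Variable T : finType.
Implicit Types (X Y : {set {set T}}) (s t tau eta : {set T}).

(* The empty simplex is required: X(-1) = {set0}.  A point of T is a vertex
   only if its singleton is a simplex, so T may have other points. *)
Definition simplicial_complex X : Prop :=
  set0 \in X /\ (forall s t, s \in X -> t \subset s -> t \in X).

(* Faces are indexed by their number of vertices rather than by dimension, to
   avoid the index -1: X(k) is [faces X k.+1] and X(-1) is [faces X 0]. *)
Definition faces X (m : nat) : {set {set T}} := [set s in X | #|s| == m].

Definition verts X : {set T} := [set v | [set v] \in faces X 1].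

Definition pure n X : Prop :=
  forall s, s \in X -> exists2 t, t \in faces X n.+1 & s \subset t.

(* The cardinality condition forces eta to be disjoint from tau. *)
Definition link X tau : {set {set T}} :=
  [set eta in X | tau :|: eta \in faces X (#|tau| + #|eta|)].

Definition adj Y : rel T := [rel u v | [set u; v] \in faces Y 2].

Definition connected_skeleton Y : Prop :=
  forall u v, u \in verts Y -> v \in verts Y -> connect (adj Y) u v.

(* Dimension at most n - 2 means fewer than n vertices. *)
Definition connected_links n X : Prop :=
  forall tau, tau \in X -> (#|tau| < n)%N -> connected_skeleton (link X tau).

Definition partite n X (S : 'I_n.+1 -> {set T}) : Prop :=
  [/\ forall i j, i != j -> [disjoint S i & S j],
      verts X = \bigcup_i S i
    & forall s, s \in faces X n.+1 -> forall i, #|s :&: S i| = 1%N].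

Definition partite_regular n X (S : 'I_n.+1 -> {set T}) : Prop :=
  forall i, exists K : nat, forall v, v \in S i ->
    #|[set s in faces X n.+1 | v \in s]| = K.

Definition transversal_faces n X (U : 'I_n.+1 -> {set T}) : {set {set T}} :=
  [set s in faces X n.+1 | [forall i, #|s :&: U i| == 1%N]].

End Complexes.

Section RandomWalk.
Variables (R : realType) (T : finType) (Y : {set {set T}}).

Definition vertex := {v : T | v \in verts Y}.

Definition degree (v : vertex) : nat :=
  #|[set u : vertex | adj Y (val v) (val u)]|.

Definition walk (phi : {ffun vertex -> R^o}) : {ffun vertex -> R^o} :=
  [ffun v => (degree v)%:R^-1 * \sum_(u : vertex | adj Y (val v) (val u)) phi u].

Fact walk_is_linear : linear walk.
Proof.
move=> a f g; apply/ffunP => v; rewrite !ffunE.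
under eq_bigr do rewrite !ffunE.
by rewrite big_split /= -scaler_sumr mulrDr scalerAr.
Qed.

HB.instance Definition _ := GRing.isLinear.Build R _ _ _ walk walk_is_linear.

Definition walk_spectrum : pred R := [pred a | passmx.leigenvalue (linfun walk) a].

End RandomWalk.

Arguments walk_spectrum R {T} Y.

Definition spectrum_bound (R : realType) (n : nat) (lambda : R) : R :=
  lambda / (1 + (n%:R - 1) * lambda).

Definition mixing_constant (R : realType) (n : nat) : R :=
  \sum_(k < n) n`!%:R * ((n + 1 - k) ^ (n - k))%:R / (n - k - 1)`!%:R
    * ((k + 1)%:R * (k + 2)%:R ^+ (n - k) - (k + 1)%:R ^+ (n - k + 1)).

(* For n > 0 the initial value f ord0 ord_max is itself one of the terms, so
   this is exactly the minimum of f i j over i < j. *)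
Definition min_lt_pairs (R : realType) n (f : 'I_n.+1 -> 'I_n.+1 -> R) : R :=
  \big[Num.min/f ord0 ord_max]_(p : 'I_n.+1 * 'I_n.+1 | (p.1 < p.2)%N)
    f p.1 p.2.

(* Main.v *)
From HB Require Import structures.
Require Import Defs.
From mathcomp Require Import all_boot all_order all_algebra.
From mathcomp Require Import reals zify ring lra.

Set Implicit Arguments.
Unset Strict Implicit.
Unset Printing Implicit Defensive.

Import Order.TTheory GRing.Theory Num.Theory.
Local Open Scope ring_scope.

(* Let x_0, ..., x_n be the vertices of a uniform random facet, x_i in S_i.
   Write <f, g> for correlations and E_K for conditional expectation given the
   vertices of colours in K.  The colours i and j have correlation at most r above
   J if 2 <f, g> <= r (|f|^2 + |g|^2) whenever f and g depend on the colours J + i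
   and J + j respectively and E_J f = E_J g = 0.

   For |J| = n - 1 this holds with mu = lambda / (1 + (n - 1) lambda): otherwise
   the best r exceeds mu and is attained, by a pair forming an eigenfunction with
   eigenvalue r of the walk on some link, and r < 1 by connectedness.
   Conditioning on one more colour shows that a bound mu above all J + k improves
   a bound r above J to mu + (1 - mu) r^2, hence the best bound, which is < 1 by
   connectedness, is at most mu / (1 - mu).  Descending from |J| = n - 1 gives
   lambda / (1 + |J| lambda) <= lambda above every J.

   Exposing the colours of A one at a time then yields
   |E_A u|^2 <= |A| lambda^2 |u|^2 for a centred function u of x_k, k not in A.
   The product of the indicators of x_k in U_k is decorrelated factor by factor,
   starting with k = i and ending with k = j; each of the n steps costs at most
   n lambda sqrt(p_i p_j), where p_k = |U_k| / |S_k|, and n^2 <= C_n. *)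

(** * Positive semidefinite forms *)

Section PsdForms.
Variables (R : realFieldType) (V : lmodType R).

(** Degenerate forms are allowed, since the defect forms compared below may vanish on nonzero
    vectors. *)
Record psd_form (B : V -> V -> R) : Prop := PsdForm {
  form_sym : forall x y, B x y = B y x;
  form_lin : forall a x y z, B (a *: x + y) z = a * B x z + B y z;
  form_ge0 : forall x, 0 <= B x x }.

Section Theory.
Variables (B : V -> V -> R) (hB : psd_form B).

Lemma form0l z : B 0 z = 0.
Proof. by have := form_lin hB 1 0 0 z; rewrite scale1r addr0 => h; lra. Qed.

Lemma formZl a x z : B (a *: x) z = a * B x z.
Proof. by have := form_lin hB a x 0 z; rewrite addr0 form0l addr0. Qed.

Lemma formDl x y z : B (x + y) z = B x z + B y z.
Proof. by have := form_lin hB 1 x y z; rewrite scale1r mul1r. Qed.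

Lemma formZr a x z : B z (a *: x) = a * B z x.
Proof. by rewrite (form_sym hB) formZl (form_sym hB). Qed.

Lemma formDr x y z : B z (x + y) = B z x + B z y.
Proof. by rewrite (form_sym hB) formDl !(form_sym hB z). Qed.

Lemma formNl x z : B (- x) z = - B x z.
Proof. by rewrite -scaleN1r formZl mulN1r. Qed.

Lemma formNr x z : B z (- x) = - B z x.
Proof. by rewrite (form_sym hB) formNl (form_sym hB). Qed.

Definition formE := (formDl, formDr, formNl, formNr, formZl, formZr).

Lemma form_CS x y : B x y ^+ 2 <= B x x * B y y.
Proof.
have hx := form_ge0 hB x; have hy := form_ge0 hB y.
have [yy0|yy0] := eqVneq (B y y) 0; last first.
  have y_gt0 : 0 < B y y by rewrite lt_def yy0.
  have := form_ge0 hB (B y y *: x - B x y *: y).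
  rewrite !formE (form_sym hB y x) => h.
  have {h} : 0 <= B y y * (B x x * B y y - B x y ^+ 2) by nra.
  by rewrite pmulr_rge0 // subr_ge0.
rewrite yy0 mulr0 leNgt; apply/negP => h.
(* With B y y = 0 the form at x - t y is B x x - 2 t B x y; this t makes it -1. *)
have := form_ge0 hB (x - ((B x x + 1) / (2 * B x y)) *: y).
rewrite !formE (form_sym hB y x) yy0.
have b0 : B x y != 0 by apply: contraTneq h => ->; rewrite expr0n ltxx.
have -> : (B x x + 1) / (2 * B x y) * B x y = (B x x + 1) / 2.
  by field.
by move=> h1; lra.
Qed.

Lemma form_null x y : B x x = 0 -> B x y = 0.
Proof.
move=> x0; have := form_CS x y; rewrite x0 mul0r => h.
by apply/eqP; rewrite -sqrf_eq0 eq_le h sqr_ge0.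
Qed.

Lemma form_CS_AM x y : 2 * B x y <= B x x + B y y.
Proof.
have := form_ge0 hB (x - y); rewrite !formE (form_sym hB y x); lra.
Qed.

End Theory.

(** Membership in the span of [l], by recursion so that an induction can remove one generator at a
    time, whether or not the list is free. *)
Fixpoint spanned (l : seq V) (x : V) : Prop :=
  if l is e :: l' then exists a, spanned l' (x - a *: e) else x = 0.

Lemma spanned_map (f : V -> V) (l : seq V) (x : V) :
  (forall a u v, f (a *: u + v) = a *: f u + f v) ->
  spanned l x -> spanned (map f l) (f x).
Proof.
move=> flin; elim: l x => [|e l IH] x /=.
  move=> ->; have := flin 1 0 0; rewrite !scale1r addr0 => /eqP.
  by rewrite addrC -subr_eq subrr => /eqP.
move=> [a /IH h]; exists a; suff -> : f x - a *: f e = f (x - a *: e) by [].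
by rewrite [x - _]addrC -!scaleNr flin addrC.
Qed.

Lemma spanned_sum n (e : 'I_n -> V) (l : seq 'I_n) (a : 'I_n -> R) :
  spanned (map e l) (\sum_(i <- l) a i *: e i).
Proof.
elim: l => [|i l IH] /=; first by rewrite big_nil.
by exists (a i); rewrite big_cons addrAC subrr add0r.
Qed.

(* Gram-Schmidt: a generator e is either null for Q, hence for P, or the other
   generators can be made Q-orthogonal to it. *)
Lemma spanned_coercive (P Q : V -> V -> R) (l : seq V) :
  psd_form P -> psd_form Q -> (forall x, Q x x = 0 -> P x x = 0) ->
  exists2 C, 0 <= C & forall x, spanned l x -> P x x <= C * Q x x.
Proof.
move=> hP hQ QP; move: {2}(size l) (erefl (size l)) => n.
elim: n l => [|n IH] [|e l] //=.
  by move=> _; exists 0 => // x ->; rewrite mul0r (form0l hP).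
move=> [sl]; have [Qe|Qe] := eqVneq (Q e e) 0.
  have [C C0 hC] := IH l sl; exists C => // x [a /hC]; rewrite !(formE hP) !(formE hQ).
  rewrite (form_sym hP x e) (form_sym hQ x e).
  by rewrite !(form_null hP _ (QP _ Qe)) !(form_null hQ _ Qe); lra.
have Qe0 : 0 < Q e e by rewrite lt_def Qe (form_ge0 hQ).
(* [f] projects along e onto its Q-orthogonal complement. It kills e, so f x = f (x - a e) lies in
   the span of [map f l]. *)
pose f u := u - (Q u e / Q e e) *: e.
have flin a u v : f (a *: u + v) = a *: f u + f v.
  rewrite /f !(formE hQ) mulrDl scalerDl scalerBr scalerA opprD.
  by rewrite mulrA addrACA.
have [|C C0 hC] := IH (map f l); first by rewrite size_map.
have PQ0 : 0 <= P e e / Q e e by rewrite divr_ge0 ?(form_ge0 hP) ?(form_ge0 hQ).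
exists (2 * (P e e / Q e e + C)); first by lra.
move=> x [a /(spanned_map flin) /hC].
have -> : f (x - a *: e) = f x.
  rewrite /f !(formE hQ) mulrDl scalerDl mulNr mulfK // scaleNr.
  by rewrite opprD opprK addrACA addNr addr0.
pose b := Q x e / Q e e.
have xE : x = b *: e + f x by rewrite addrC subrK.
have Qf : Q (f x) e = 0 by rewrite !(formE hQ) divfK // subrr.
move: (f x) xE Qf => y -> Qf h.
have h1 : P (b *: e + y) (b *: e + y) <= 2 * (b ^+ 2 * P e e) + 2 * P y y.
  have := form_ge0 hP (b *: e - y); rewrite !(formE hP) (form_sym hP y e); nra.
apply: (le_trans h1).
have -> : Q (b *: e + y) (b *: e + y) = b ^+ 2 * Q e e + Q y y.
  by rewrite !(formE hQ) (form_sym hQ e y) Qf; ring.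
have Qy := form_ge0 hQ y.
have e1 : b ^+ 2 * P e e = P e e / Q e e * (b ^+ 2 * Q e e) by field.
have h2 : 0 <= P e e / Q e e * Q y y by rewrite mulr_ge0.
have h3 : 0 <= C * (b ^+ 2 * Q e e).
  by apply: mulr_ge0 => //; apply: mulr_ge0; [exact: sqr_ge0 | exact: ltW].
by rewrite e1; move: (P e e / Q e e) (b ^+ 2 * Q e e) h2 h3 => p r; lra.
Qed.

End PsdForms.

Lemma form_coercive (R : realFieldType) (V : vectType R) (P Q : V -> V -> R) :
  psd_form P -> psd_form Q -> (forall x, Q x x = 0 -> P x x = 0) ->
  exists2 C, 0 <= C & forall x, P x x <= C * Q x x.
Proof.
move=> hP hQ QP.
have [C C0 hC] := spanned_coercive
  (map (fun i => (vbasis {:V})`_(i : 'I_(\dim {:V}))) (index_enum _)) hP hQ QP.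
exists C => // x; apply: hC.
have := spanned_sum (fun i : 'I_(\dim {:V}) => (vbasis {:V})`_i) (index_enum _)
  (fun i => coord (vbasis {:V}) i x).
by rewrite -(coord_vbasis (memvf x)).
Qed.

(** The infimum of the admissible s >= m is itself admissible, because the inequalities are closed
    conditions on s. If it exceeded m, the step hypothesis would give a smaller admissible value. *)
Lemma descent (R : realType) (Y : Type) (D : Y -> Prop) (a b : Y -> R) (m s0 : R) :
  (forall y, D y -> 0 <= b y) -> m <= s0 ->
  (forall y, D y -> a y <= s0 * b y) ->
  (forall s, m < s <= s0 -> (forall y, D y -> a y <= s * b y) ->
     exists2 s', s' < s & forall y, D y -> a y <= s' * b y) ->
  forall y, D y -> a y <= m * b y.
Proof.
move=> b0 ms0 hs0 hstep.
pose A (s : R) := m <= s /\ forall y, D y -> a y <= s * b y.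
have lbA : classical_sets.lbound A m by move=> s [].
have A0 : A s0 by [].
have infm : m <= inf A by apply: lb_le_inf; [exists s0 | exact: lbA].
have hinf : forall y, D y -> a y <= inf A * b y.
  move=> y Dy; have := b0 y Dy; rewrite le_eqVlt => /predU1P[by0|by0].
    by have := hs0 y Dy; rewrite -by0 !mulr0.
  rewrite -ler_pdivrMr //; apply: lb_le_inf; first by exists s0.
  by move=> s [_ /(_ y Dy)]; rewrite ler_pdivrMr.
move: infm; rewrite le_eqVlt => /predU1P[->//|infm].
have [|s' s'lt hs'] := hstep (inf A) _ hinf.
  by rewrite infm ge_inf //; exists m.
have : inf A <= Num.max m s'.
  apply: ge_inf; first by exists m.
  split=> [|y Dy]; first by rewrite le_max lexx.
  by apply: le_trans (hs' y Dy) _; rewrite ler_wpM2r ?b0 // le_max lexx orbT.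
by rewrite leNgt gt_max infm s'lt.
Qed.
(** * Conditional expectations and trickling down *)

Section Averages.
Variables (R : realFieldType) (O I : finType) (D : eqType) (c : I -> O -> D).
Local Notation V := {ffun O -> R^o}.
Implicit Types (K L J : {set I}) (f g : V) (s t : O).

Definition agree K : rel O := [rel s t | [forall i in K, c i s == c i t]].

Lemma agreeP K s t : reflect {in K, forall i, c i s = c i t} (agree K s t).
Proof. by apply: (iffP forall_inP) => h i /h /eqP. Qed.

Lemma agree_refl K s : agree K s s. Proof. exact/agreeP. Qed.

Lemma agree_sym K s t : agree K s t = agree K t s.
Proof. by apply/agreeP/agreeP => h i /h. Qed.

Lemma agree_eqr K s t : agree K s t -> agree K s =1 agree K t.
Proof.
move=> /agreeP st u; apply/agreeP/agreeP => h i iK.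
  by rewrite -st // h.
by rewrite st // h.
Qed.

Lemma agree_sub K L s t : K \subset L -> agree L s t -> agree K s t.
Proof. by move=> /subsetP KL /agreeP h; apply/agreeP => i /KL /h. Qed.

Definition ip f g : R := \sum_s f s * g s.

Lemma ip_psd : psd_form ip.
Proof.
split=> [f g|a f g h|f]; rewrite /ip.
- by apply: eq_bigr => s _; rewrite mulrC.
- rewrite mulr_sumr -big_split /=; apply: eq_bigr => s _.
  by rewrite !ffunE mulrDl -mulrA.
- by apply: sumr_ge0 => s _; rewrite -expr2 sqr_ge0.
Qed.

Lemma ip_eq0 f : ip f f = 0 -> f = 0.
Proof.
move=> /eqP; rewrite psumr_eq0 => [/allP h|s _]; last by rewrite -expr2 sqr_ge0.
apply/ffunP => s; rewrite ffunE; apply/eqP.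
by have := h s (mem_index_enum s); rewrite /= mulf_eq0 orbb.
Qed.

Lemma ip_nondegenerate f g : (forall h, ip f h = ip g h) -> f = g.
Proof.
move=> fg; apply/eqP; rewrite -subr_eq0; apply/eqP/ip_eq0.
by rewrite (formDl ip_psd) (formNl ip_psd) fg subrr.
Qed.

(** The conditional expectation E_K for the uniform measure on O. The equation [avg K f = f] is used
    to say that f depends only on the coordinates in K. *)
Definition avg K f : V :=
  [ffun s => #|agree K s|%:R^-1 * \sum_(t | agree K s t) f t].

Fact avg_is_linear K : linear (avg K).
Proof.
move=> a f g; apply/ffunP => s; rewrite !ffunE.
under eq_bigr do rewrite !ffunE.
by rewrite big_split /= -scaler_sumr mulrDr scalerAr.
Qed.

HB.instance Definition _ K := GRing.isLinear.Build R V V _ (avg K) (avg_is_linear K).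

Lemma card_agree_neq0 K s : #|agree K s|%:R != 0 :> R.
Proof. by rewrite pnatr_eq0 -lt0n; apply/card_gt0P; exists s; apply: agree_refl. Qed.

Lemma avg_adj K f g : ip (avg K f) g = ip f (avg K g).
Proof.
pose w s : R := #|agree K s|%:R^-1.
have -> : ip (avg K f) g = \sum_s \sum_(t | agree K s t) w s * f t * g s.
  by apply: eq_bigr => s _; rewrite ffunE mulr_sumr mulr_suml.
have -> : ip f (avg K g) = \sum_s \sum_(t | agree K s t) w s * f s * g t.
  apply: eq_bigr => s _; rewrite ffunE mulrCA mulrA mulr_sumr.
  by apply: eq_bigr.
rewrite (exchange_big_dep xpredT) //=; apply: eq_bigr => t _.
apply: eq_big => [s|s st]; first exact: agree_sym.
by rewrite /w (eq_card (agree_eqr st)).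
Qed.

Lemma avg_id K f : (forall s t, agree K s t -> f s = f t) -> avg K f = f.
Proof.
move=> h; apply/ffunP => s; rewrite ffunE.
rewrite (eq_bigr (fun=> f s)) => [|t st]; last by rewrite (h s t).
have -> : \sum_(t | agree K s t) f s = #|agree K s|%:R * f s.
  by rewrite mulr_natl -sumr_const; apply: eq_bigl.
by rewrite mulKf ?card_agree_neq0.
Qed.

Lemma avg_agree K f s t : agree K s t -> avg K f s = avg K f t.
Proof.
by move=> /agree_eqr st; rewrite !ffunE (eq_card st); under eq_bigl do rewrite st.
Qed.

Lemma avg_fix_agree K f s t : avg K f = f -> agree K s t -> f s = f t.
Proof. by move=> <-; exact: avg_agree. Qed.

Lemma avg_fine K L f : K \subset L -> avg L (avg K f) = avg K f.
Proof. by move=> KL; apply: avg_id => s t /(agree_sub KL); exact: avg_agree. Qed.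

Lemma avg_coarse K L f : K \subset L -> avg K (avg L f) = avg K f.
Proof.
move=> KL; apply: ip_nondegenerate => h.
by rewrite avg_adj avg_adj avg_fine // -avg_adj.
Qed.

Lemma avg_idem K f : avg K (avg K f) = avg K f.
Proof. exact: avg_fine. Qed.

Lemma avg_fix_sub K L f : K \subset L -> avg K f = f -> avg L f = f.
Proof. by move=> KL <-; rewrite avg_fine. Qed.

Lemma ip_avg_avg K f g : ip (avg K f) (avg K g) = ip (avg K f) g.
Proof. by rewrite -avg_adj avg_idem. Qed.

(** [avg K] is an orthogonal projection, so this is Pythagoras in polarised form. *)
Lemma ip_sub_avg K f g :
  ip (f - avg K f) (g - avg K g) = ip f g - ip (avg K f) (avg K g).
Proof.
by rewrite !(formE ip_psd) !ip_avg_avg -avg_adj; ring.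
Qed.

Lemma ip_avg_le K f : ip (avg K f) (avg K f) <= ip f f.
Proof. by have := form_ge0 ip_psd (f - avg K f); rewrite ip_sub_avg; lra. Qed.

Lemma avg0E f s : avg set0 f s = (\sum_t f t) / #|O|%:R.
Proof.
have h : agree set0 s =1 xpredT by move=> t; apply/agreeP => i; rewrite inE.
rewrite ffunE mulrC (eq_bigl _ _ h); congr (_ / _%:R); exact: eq_card.
Qed.

(** * Oscillating functions and correlation bounds *)

Definition oscillating J i f := avg (i |: J) f = f /\ avg J f = 0.

(** For r >= 0 this is equivalent by scaling to <f, g> <= r |f| |g|. In this shape the defect is a
    quadratic form in the pair (f, g), as [pair_bound_improve] uses, and affine in r, as [descent]
    uses. *)
Definition pair_bound J i j (r : R) := forall f g,
  oscillating J i f -> oscillating J j g -> 2 * ip f g <= r * (ip f f + ip g g).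

Definition correlation_bound J (r : R) := forall i j,
  i \notin J -> j \notin J -> i != j -> pair_bound J i j r.

Lemma pair_bound_le J i j r r' :
  r <= r' -> pair_bound J i j r -> pair_bound J i j r'.
Proof.
move=> rr' h f g hf hg; apply: le_trans (h f g hf hg) _.
by rewrite ler_wpM2r // addr_ge0 ?(form_ge0 ip_psd).
Qed.

Lemma correlation_bound_le J r r' :
  r <= r' -> correlation_bound J r -> correlation_bound J r'.
Proof. by move=> rr' h i j iJ jJ ij; apply: pair_bound_le rr' (h i j iJ jJ ij). Qed.

Lemma oscillating_avg J i k f : oscillating J i f -> oscillating J k (avg (k |: J) f).
Proof. by move=> [_ f0]; split; rewrite ?avg_idem // avg_coarse ?subsetUr. Qed.

Lemma oscillating_sub J i f :
  avg (i |: J) f = f -> oscillating J i (f - avg J f).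
Proof.
by move=> fi; split; rewrite linearB /= ?avg_idem ?subrr // fi avg_fine ?subsetUr.
Qed.

(** With h the average of f, <h, f> = |h|^2, so the bound for the pair (h / r, f) reads 2 |h|^2 / r
    <= |h|^2 / r + r |f|^2; the weight 1 / r balances the two squares. *)
Lemma contraction J r i k f : 0 < r -> correlation_bound J r ->
  i \notin J -> k \notin J -> k != i -> oscillating J i f ->
  ip (avg (k |: J) f) (avg (k |: J) f) <= r ^+ 2 * ip f f.
Proof.
move=> r0 hr iJ kJ ki hf; set h := avg _ _.
have hO : oscillating J k (r^-1 *: h).
  by have [h1 h2] := oscillating_avg k hf; split; rewrite linearZ /= ?h1 ?h2 ?scaler0.
have := hr k i kJ iJ ki _ _ hO hf.
rewrite !(formE ip_psd) -[ip h f]ip_avg_avg -/h.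
have -> : r * (r^-1 * (r^-1 * ip h h) + ip f f) = r^-1 * ip h h + r * ip f f.
  by field; rewrite gt_eqF.
move=> ineq; have {}ineq : r^-1 * ip h h <= r * ip f f by lra.
by move: ineq; rewrite mulrC ler_pdivrMr // => /le_trans; apply; rewrite expr2; lra.
Qed.

(* The martingale differences of [avg A u], A growing one coordinate at a time,
   are orthogonal and each is bounded by [contraction]. *)
Lemma martingale r k u (A : {set I}) : 0 < r ->
  (forall J, (#|J|.+1 < #|I|)%N -> correlation_bound J r) ->
  k \notin A -> oscillating set0 k u ->
  ip (avg A u) (avg A u) <= #|A|%:R * r ^+ 2 * ip u u.
Proof.
move=> r0 hr + [uk u0].
move: {2}#|A| (erefl #|A|) => m; elim: m A => [|m IH] A.
  by move=> /eqP; rewrite cards_eq0 => /eqP -> _; rewrite u0 (form0l ip_psd) cards0 !mul0r.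
move=> Am kA; have [a aA] : exists a, a \in A by apply/card_gt0P; rewrite Am.
pose B := A :\ a; have AE : A = a |: B by rewrite setD1K.
have aB : a \notin B by rewrite !inE eqxx.
have kB : k \notin B by rewrite !inE negb_and kA orbT.
have ak : a != k by apply: contraNneq kA => <-.
have Bm : #|B| = m by move: Am; rewrite AE cardsU1 aB => -[].
pose v := u - avg B u.
have vO : oscillating B k v.
  by apply: oscillating_sub; apply: avg_fix_sub uk; rewrite setU0 sub1set setU11.
have vle : ip v v <= ip u u.
  by rewrite ip_sub_avg gerBl (form_ge0 ip_psd).
have Bsz : (#|B|.+1 < #|I|)%N.
  rewrite -(cardC B) -addn2 leq_add2l.
  have <- : #|[set a; k]| = 2%N by rewrite cards2 ak.
  by apply/subset_leq_card/subsetP => x /set2P[] ->; rewrite inE.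
have h1 := contraction r0 (hr _ Bsz) kB aB ak vO.
have h2 := IH B Bm kB.
have -> : ip (avg A u) (avg A u) = ip (avg B u) (avg B u) + ip (avg A v) (avg A v).
  have BA : B \subset A by rewrite AE subsetUr.
  have -> : avg A v = avg A u - avg B (avg A u).
    by rewrite linearB /= (avg_fine _ BA) (avg_coarse _ BA).
  by rewrite ip_sub_avg (avg_coarse _ BA); ring.
rewrite -AE in h1; rewrite Am -Bm -natr1.
have r2 : 0 <= r ^+ 2 by exact: sqr_ge0.
by have := ler_wpM2l r2 vle; lra.
Qed.

(* A pair bound that cannot be improved is attained by a pair of eigenvectors. *)
Lemma pair_bound_improve J i j r : pair_bound J i j r ->
  (forall f g, oscillating J i f -> oscillating J j g ->
     avg (i |: J) g = r *: f -> avg (j |: J) f = r *: g -> f = 0 /\ g = 0) ->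
  exists2 r', r' < r & pair_bound J i j r'.
Proof.
move=> hr hnull.
(* [A k] projects onto the functions oscillating in k above J, so the constrained bound becomes a
   statement about forms on all pairs of functions. *)
pose A k f := avg (k |: J) f - avg J f.
have A_osc k f : oscillating J k (A k f).
  split; rewrite linearB /= ?avg_idem.
    by rewrite (avg_fine _ (subsetUr _ _)).
  by rewrite (avg_coarse _ (subsetUr _ _)) subrr.
have A_id k f : oscillating J k f -> A k f = f by move=> [h1 h2]; rewrite /A h1 h2 subr0.
have A_lin k a f g : A k (a *: f + g) = a *: A k f + A k g.
  by rewrite /A !avg_is_linear scalerBr opprD addrACA.
have A_adj k f g : ip (A k f) g = ip f (A k g).
  by rewrite !(formE ip_psd) !avg_adj.
pose P (x y : V * V) := ip (A i x.1) (A i y.1) + ip (A j x.2) (A j y.2).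
pose X (x y : V * V) := ip (A i x.1) (A j y.2).
pose Q x y := r * P x y - X x y - X y x.
have hP : psd_form P.
  split=> [x y|a x y z|x]; rewrite /P.
  - by rewrite (form_sym ip_psd) [X in _ + X](form_sym ip_psd).
  - by rewrite /= !A_lin !(form_lin ip_psd); ring.
  - by rewrite addr_ge0 ?(form_ge0 ip_psd).
have hQ : psd_form Q.
  split=> [x y|a x y z|x]; rewrite /Q.
  - by rewrite (form_sym hP) addrAC.
  - by rewrite (form_lin hP) /X /= !A_lin !(formE ip_psd); ring.
  - by have := hr _ _ (A_osc i x.1) (A_osc j x.2); rewrite /P /X; lra.
(* A null vector of the defect Q lies in its radical; pairing it with (h, 0) and (0, h) gives the
   two eigenvector equations. *)
have [[f g] Q0|C C0 hC] := form_coercive hP hQ.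
  have [fO gO] := (A_osc i f, A_osc j g).
  suff [f0 g0] : A i f = 0 /\ A j g = 0 by rewrite /P /= f0 g0 !(form0l ip_psd) addr0.
  apply: hnull => //; apply: ip_nondegenerate => h; rewrite (formZl ip_psd).
    have := form_null hQ (h, 0) Q0; rewrite /Q /P /X /=.
    have -> : A j 0 = 0 by rewrite /A !linear0 addr0.
    have [_ g0] := gO.
    have -> : avg (i |: J) (A j g) = A i (A j g) by rewrite -[LHS]subr0 -g0.
    rewrite (form_sym ip_psd _ 0) (form_sym ip_psd _ 0) !(form0l ip_psd).
    rewrite -[ip (A i f) (A i h)]A_adj (A_id _ _ fO) (form_sym ip_psd (A i h)).
    by rewrite [ip (A i (A j g)) h]A_adj; lra.
  have := form_null hQ (0, h) Q0; rewrite /Q /P /X /=.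
  have -> : A i 0 = 0 by rewrite /A !linear0 addr0.
  have [_ f0] := fO.
  have -> : avg (j |: J) (A i f) = A j (A i f) by rewrite -[LHS]subr0 -f0.
  rewrite (form_sym ip_psd _ 0) !(form0l ip_psd).
  rewrite -[ip (A j g) (A j h)]A_adj (A_id _ _ gO).
  by rewrite [ip (A j (A i f)) h]A_adj; lra.
(* P <= C Q gives Q >= P / (C + 1), so r can drop by 1 / (C + 1); adding 1 keeps the divisor
   positive when C = 0. *)
exists (r - (C + 1)^-1) => [|f g fO gO].
  by rewrite gtrBl invr_gt0; lra.
have := hC (f, g); have := form_ge0 hQ (f, g).
rewrite /Q /P /X /= !A_id //; move: (ip f f + _) => p q0 hp.
have {}hp : p / (C + 1) <= r * p - 2 * ip f g by rewrite ler_pdivrMr; lra.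
by rewrite mulrBl [_^-1 * _]mulrC; lra.
Qed.

Lemma pair_bound1 J i j : pair_bound J i j 1.
Proof. by move=> f g _ _; rewrite mul1r; exact: (form_CS_AM ip_psd). Qed.

(** If 1 is attained, f and g are averages of each other, hence of equal norm and equal. The common
    function depends on J + i and on J + j, so on J alone by hypothesis, and its J-average is 0. *)
Lemma pair_bound_lt1 J i j :
  (forall f, avg (i |: J) f = f -> avg (j |: J) f = f -> avg J f = f) ->
  exists2 r, r < 1 & pair_bound J i j r.
Proof.
move=> hJ; apply: pair_bound_improve (@pair_bound1 J i j) _ => f g [fi f0] [gj g0].
rewrite !scale1r => gf fg.
have E : g - avg (i |: J) g = 0.
  apply: ip_eq0; apply/eqP; rewrite eq_le (form_ge0 ip_psd) andbT ip_sub_avg gf.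
  by rewrite -{1 2}fg subr_le0 ip_avg_le.
move/eqP: E; rewrite subr_eq0 gf => /eqP gE; rewrite {}gE in gj g0 *.
by rewrite -(hJ f).
Qed.

Lemma correlation_bound_lt1 J :
  (forall i j f, i \notin J -> j \notin J -> i != j ->
     avg (i |: J) f = f -> avg (j |: J) f = f -> avg J f = f) ->
  exists2 r, r < 1 & correlation_bound J r.
Proof.
move=> hJ.
have : forall p : I * I, exists r, r < 1 /\
    (p.1 \notin J -> p.2 \notin J -> p.1 != p.2 -> pair_bound J p.1 p.2 r).
  move=> [i j] /=.
  have [/and3P[iJ jJ ij]|h] := boolP [&& i \notin J, j \notin J & i != j].
    by have [|r r1 hr] := @pair_bound_lt1 J i j; [move=> f; exact: hJ | exists r].
  exists 0; split=> // iJ jJ ij; by rewrite iJ jJ ij in h.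
move=> /fin_all_exists[r hr]; exists (\big[Num.max/0]_p r p).
  by elim/big_ind: _ => // [a b a1 b1|p _]; [rewrite gt_max a1 | case: (hr p)].
move=> i j iJ jJ ij; have [_ /(_ iJ jJ ij)] := hr (i, j).
by apply: pair_bound_le; rewrite (le_bigmax _ r).
Qed.

(** Split <f, g> by conditioning on a third colour k. The fluctuations obey the bound mu, and by
    [contraction] the averages have squared norm at most r^2 times the original. The fluctuations
    have lost the norm of the averages, whence the factor 1 - mu. *)
Lemma trickle_step J mu r : 0 < mu < 1 -> 0 < r -> (#|J|.+2 < #|I|)%N ->
  (forall k, k \notin J -> correlation_bound (k |: J) mu) ->
  correlation_bound J r -> correlation_bound J (mu + (1 - mu) * r ^+ 2).
Proof.
move=> /andP[mu0 mu1] r0 JI hmu hr i j iJ jJ ij f g fO gO.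
have [k] : exists k, k \notin [set i; j] :|: J.
  apply/existsP; rewrite -negb_forall; apply: contraTN JI => /forallP h.
  rewrite -leqNgt -cardsT (_ : [set: I] = [set i; j] :|: J).
    by rewrite (leq_trans (leq_card_setU _ _)) // cards2 ij.
  by apply/setP => k; rewrite h inE.
rewrite !inE !negb_or => /andP[/andP[ki kj] kJ].
have sub l h : oscillating J l h -> oscillating (k |: J) l (h - avg (k |: J) h).
  move=> [hl _]; apply: oscillating_sub; apply: avg_fix_sub hl.
  by rewrite setUCA subsetUr.
have iK : i \notin k |: J by rewrite !inE negb_or eq_sym ki.
have jK : j \notin k |: J by rewrite !inE negb_or eq_sym kj.
have := hmu k kJ i j iK jK ij _ _ (sub _ _ fO) (sub _ _ gO).
rewrite !ip_sub_avg.
have := contraction r0 hr iJ kJ ki fO; have := contraction r0 hr jJ kJ kj gO.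
have := form_CS_AM ip_psd (avg (k |: J) f) (avg (k |: J) g).
move: (avg _ f) (avg _ g) => f1 g1 h1 h2 h3 h4.
have h5 : (1 - mu) * (ip f1 f1 + ip g1 g1) <= (1 - mu) * (r ^+ 2 * (ip f f + ip g g)).
  by rewrite ler_wpM2l //; lra.
lra.
Qed.

End Averages.

(* The map mu + (1 - mu) r^2 is below the identity between its fixed points
   mu / (1 - mu) and 1. *)
Lemma trickle_down (R : realType) (O I : finType) (D : eqType) (c : I -> O -> D)
    (J : {set I}) (mu m r0 : R) :
  0 < mu < 1 -> m * (1 - mu) = mu -> (#|J|.+2 < #|I|)%N ->
  (forall k, k \notin J -> correlation_bound c (k |: J) mu) ->
  r0 < 1 -> correlation_bound c J r0 -> correlation_bound c J m.
Proof.
move=> mu01 mE JI hmu r01 hr0.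
have [m0|m0] := leP r0 m; first exact: correlation_bound_le hr0.
pose V := {ffun O -> R^o}.
pose Dom (y : I * I * (V * V)) := [/\ y.1.1 \notin J, y.1.2 \notin J, y.1.1 != y.1.2,
  oscillating c J y.1.1 y.2.1 & oscillating c J y.1.2 y.2.2].
have DomP r : correlation_bound c J r <-> forall y, Dom y ->
    2 * ip y.2.1 y.2.2 <= r * (ip y.2.1 y.2.1 + ip y.2.2 y.2.2).
  split=> [h [[i j] [f g]] [iJ jJ ij fO gO]|h i j iJ jJ ij f g fO gO].
    exact: (h i j).
  by apply: (h ((i, j), (f, g))); split.
apply/DomP; apply: (descent _ (ltW m0)) (proj1 (DomP r0) hr0) _.
  by move=> y _; rewrite addr_ge0 ?(form_ge0 (ip_psd _ _)).
move=> r /andP[mr rr0] /DomP hr; exists (mu + (1 - mu) * r ^+ 2); last first.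
  apply/DomP/trickle_step => //; apply: lt_trans mr.
  by case/andP: mu01 => mu0 mu1; rewrite -(pmulr_lgt0 _ (_ : 0 < 1 - mu)) ?mE // subr_gt0.
case/andP: mu01 => mu0 mu1.
(* This product equals r - mu - (1 - mu) r^2, because m (1 - mu) = mu. *)
have h : 0 < (1 - r) * (r - m) * (1 - mu) by rewrite !mulr_gt0 ?subr_gt0 // (le_lt_trans rr0).
nra.
Qed.

(** * Mixing for product indicators *)

Section ExpanderMixing.
Variables (R : realType) (O I : finType) (D : eqType) (c : I -> O -> D).
Local Notation V := {ffun O -> R^o}.
Implicit Types (J A B : {set I}) (f g : V).

(** * Correlation bounds from connectedness and from the links of codimension two *)

Section Spectral.

Hypothesis connected : forall J f, (#|J|.+1 < #|I|)%N ->
  (forall k, k \notin J -> avg c (k |: J) f = f) -> avg c J f = f.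

(** Induction on the number of colours outside J: for a third colour k, the claim above J + k shows
    that f depends on J + k only, so [connected] applies. *)
Lemma connected_pair J i j f : (#|J|.+1 < #|I|)%N ->
  i \notin J -> j \notin J -> i != j ->
  avg c (i |: J) f = f -> avg c (j |: J) f = f -> avg c J f = f.
Proof.
move: {2}(#|I| - #|J|)%N (leqnn (#|I| - #|J|)) => m.
elim: m J => [|m IH] J Jm JI iJ jJ ij fi fj; first by lia.
apply: connected => // k kJ.
have [->//|ki] := eqVneq k i; have [->//|kj] := eqVneq k j.
have Kc : #|k |: J| = #|J|.+1 by rewrite cardsU1 kJ.
have KI : (#|J|.+2 < #|I|)%N.
  have := max_card (mem (k |: (i |: (j |: J)))).
  by rewrite !cardsU1 !inE !negb_or ki kj ij kJ iJ jJ !add1n.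
have sub l : avg c (l |: J) f = f -> avg c (l |: (k |: J)) f = f.
  by apply: avg_fix_sub; rewrite setUCA subsetUr.
apply: IH; rewrite ?Kc //; [by lia | | | exact: sub | exact: sub].
- by rewrite !inE negb_or eq_sym ki.
- by rewrite !inE negb_or eq_sym kj.
Qed.

Lemma correlation_bound_start J : (#|J|.+1 < #|I|)%N ->
  exists2 r, r < 1 & correlation_bound (R := R) c J r.
Proof.
by move=> JI; apply: correlation_bound_lt1 => i j f iJ jJ ij; apply: connected_pair.
Qed.

(** By [descent] from a bound below 1: a bound r with mu < r < 1 that admits no nonzero eigenpair is
    not attained, so [pair_bound_improve] lowers it. *)
Lemma correlation_bound_top J (mu : R) : (#|J|.+1 < #|I|)%N ->
  (forall i j r f g, i \notin J -> j \notin J -> i != j -> mu < r < 1 ->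
     oscillating c J i f -> oscillating c J j g ->
     avg c (i |: J) g = r *: f -> avg c (j |: J) f = r *: g -> f = 0 /\ g = 0) ->
  correlation_bound c J mu.
Proof.
move=> JI hnull i j iJ jJ ij.
have [r0 r01 /(_ i j iJ jJ ij) hr0] := correlation_bound_start JI.
have [m0|m0] := leP r0 mu; first exact: pair_bound_le hr0.
pose Dom (y : V * V) := oscillating c J i y.1 /\ oscillating c J j y.2.
have DomP r : pair_bound c J i j r <-> forall y, Dom y ->
    2 * ip y.1 y.2 <= r * (ip y.1 y.1 + ip y.2 y.2).
  by split=> [h [f g] [fO gO]|h f g fO gO]; [exact: h | apply: (h (f, g)); split].
apply/DomP; apply: (descent _ (ltW m0)) (proj1 (DomP r0) hr0) _.
  by move=> y _; rewrite addr_ge0 ?(form_ge0 (ip_psd _ _)).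
move=> r /andP[mr rr0] /DomP hr.
have [|r' r'r /DomP hr'] := pair_bound_improve hr; last by exists r'.
by move=> f g; apply: hnull => //; rewrite mr (le_lt_trans rr0).
Qed.

Variable lambda : R.
Hypothesis lambda01 : 0 < lambda < 1.
Hypothesis top_bound : forall J, #|J|.+2 = #|I| ->
  correlation_bound c J (lambda / (1 + #|J|%:R * lambda)).

(** Descending induction on a = [#|J|]: for mu = lambda / (1 + (a + 1) lambda), the fixed point mu /
    (1 - mu) of [trickle_down] is lambda / (1 + a lambda). *)
Lemma correlation_bound_all J : (#|J|.+1 < #|I|)%N -> correlation_bound c J lambda.
Proof.
move=> JI; suff : correlation_bound c J (lambda / (1 + #|J|%:R * lambda)).
  apply: correlation_bound_le; case/andP: lambda01 => l0 l1.
  by rewrite ler_pdivrMr ?ler_peMr ?ltr_pwDl ?lerDl ?mulr_ge0 // ltW.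
move: {2}(#|I| - #|J|)%N (leqnn (#|I| - #|J|)) => m.
elim: m J JI => [|m IH] J JI Jm; first by lia.
move: (JI); rewrite leq_eqVlt => /predU1P[/top_bound//|JI3].
have [r0 r01 hr0] := correlation_bound_start JI.
case/andP: lambda01 => l0 l1; have a0 : 0 <= #|J|%:R * lambda by rewrite mulr_ge0 // ltW.
apply: (@trickle_down _ _ _ _ _ _ (lambda / (1 + (#|J|.+1)%:R * lambda)) _ r0) => //.
- rewrite -natr1 mulrDl mul1r divr_gt0 ?ltr_pdivrMr; lra.
- by rewrite -natr1; field; apply/andP; split; lra.
- by move=> k kJ; have := IH (k |: J); rewrite cardsU1 kJ add1n; apply; lia.
Qed.

End Spectral.

(** * Decorrelating a product of indicators *)

Variables (lambda : R) (lambda_gt0 : 0 < lambda).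
Hypothesis hlambda : forall J, (#|J|.+1 < #|I|)%N -> correlation_bound c J lambda.

Definition mean (h : O -> R) : R := (\sum_s h s) / #|O|%:R.

Variable f : I -> V.
Hypothesis f01 : forall k s, f k s = 0 \/ f k s = 1.
Hypothesis f_coord : forall k, avg c [set k] (f k) = f k.
Local Notation n := (#|I|.-1).
Local Notation p k := (mean (f k)).

Let F A : V := [ffun s => \prod_(k in A) f k s].

Let F01 A s : F A s = 0 \/ F A s = 1.
Proof.
rewrite ffunE; elim/big_rec: _ => [|k x _ [] ->]; first by right.
  by left; rewrite mulr0.
by rewrite mulr1; exact: f01.
Qed.

Let F_avg A : avg c A (F A) = F A.
Proof.
apply: avg_id => s t /agreeP st; rewrite !ffunE; apply: eq_bigr => k kA.
apply: (avg_fix_agree (f_coord k)); apply/agreeP => j /set1P ->; exact: st.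
Qed.

Let F_sqr A : ip (F A) (F A) = \sum_s F A s.
Proof. by apply: eq_bigr => s _; case: (F01 A s) => ->; rewrite ?mulr0 ?mulr1. Qed.

Let F_le A j s : j \in A -> F A s <= f j s.
Proof.
move=> jA; rewrite ffunE (bigD1 j) //=.
have : F (A :\ j) s <= 1 by case: (F01 (A :\ j) s) => ->.
have -> : F (A :\ j) s = \prod_(k in A | k != j) f k s.
  by rewrite ffunE; apply: eq_bigl => k; rewrite !inE andbC.
by case: (f01 j s) => ->; rewrite ?mul0r ?mul1r.
Qed.

Let mean_ge0 (h : V) : (forall s, 0 <= h s) -> 0 <= mean h.
Proof. by move=> h0; rewrite divr_ge0 // sumr_ge0. Qed.

Let p_ge0 k : 0 <= p k.
Proof. by apply: mean_ge0 => s; case: (f01 k s) => ->. Qed.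

Let p_le1 k : p k <= 1.
Proof.
rewrite /mean; have [O0|O0] := posnP #|O|; first by rewrite O0 invr0 mulr0.
rewrite ler_pdivrMr ?ltr0n // mul1r.
rewrite -[#|O|%:R](mulr_natl 1) mulr1 -sumr_const.
by apply: ler_sum => s _; case: (f01 k s) => ->.
Qed.

Let FU1 k A s : k \notin A -> F (k |: A) s = f k s * F A s.
Proof. by move=> kA; rewrite !ffunE big_setU1. Qed.

Let bound k j := n%:R * lambda * Num.sqrt (p k * p j).

(** The difference is the covariance of f_k and F_A, that is <E_A u, F_A> / |O|. Cauchy-Schwarz
    leaves |E_A u|, bounded by [martingale], and |F_A|^2 <= p_j |O|, since j in A gives F_A <=
    f_j. *)
Lemma peel k j A : k \notin A -> j \in A ->
  `|mean (F (k |: A)) - p k * mean (F A)| <= bound k j.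
Proof.
move=> kA jA; pose u := f k - avg c set0 (f k).
have uO : oscillating c set0 k u.
  by apply: oscillating_sub; rewrite setU0.
have -> : mean (F (k |: A)) - p k * mean (F A) = ip (avg c A u) (F A) / #|O|%:R.
  rewrite avg_adj F_avg /mean mulrA -mulrBl /ip; congr (_ / _).
  rewrite mulr_sumr -sumrB; apply: eq_bigr => s _; rewrite FU1 //.
  have -> : u s = f k s - p k by rewrite /u ffunE [X in _ + X = _]ffunE avg0E.
  by rewrite mulrBl.
have [O0|O0] := posnP #|O|.
  by rewrite O0 invr0 mulr0 normr0 !mulr_ge0 ?sqrtr_ge0 // ltW.
have O0R : 0 < #|O|%:R :> R by rewrite ltr0n.
have nl0 : 0 <= n%:R * lambda by rewrite mulr_ge0 // ltW.
rewrite -sqrtr_sqr /bound -[n%:R * lambda]ger0_norm // -sqrtr_sqr -sqrtrM ?sqr_ge0 //.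
apply: ler_wsqrtr; rewrite expr_div_n ler_pdivrMr ?exprn_gt0 //.
apply: le_trans (form_CS (ip_psd _ _) _ _) _.
have An : (#|A| <= n)%N.
  have := max_card (mem (k |: A)); rewrite cardsU1 kA; lia.
have h1 : ip (avg c A u) (avg c A u) <= (n%:R * lambda) ^+ 2 * (p k * #|O|%:R).
  apply: le_trans (martingale lambda_gt0 hlambda kA uO) _.
  apply: ler_pM.
  - by rewrite mulr_ge0 ?sqr_ge0.
  - exact: form_ge0 (ip_psd _ _) _.
  (* The factor [#|A|] is weakened to n^2, so that the square root is n lambda. *)
  - rewrite exprMn ler_wpM2r ?sqr_ge0 // -natrX ler_nat.
    by apply: leq_trans An _; rewrite -mulnn; case: n => // m; rewrite leq_pmulr.
  rewrite ip_sub_avg divfK ?gt_eqF //.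
  have -> : \sum_s f k s = ip (f k) (f k).
    by apply: eq_bigr => s _; case: (f01 k s) => ->; rewrite ?mulr0 ?mulr1.
  by rewrite gerBl (form_ge0 (ip_psd _ _)).
have h2 : ip (F A) (F A) <= p j * #|O|%:R.
  by rewrite F_sqr divfK ?gt_eqF //; apply: ler_sum => s _; exact: F_le.
apply: le_trans (ler_pM _ _ h1 h2) _; rewrite ?(form_ge0 (ip_psd _ _)) //.
by rewrite le_eqVlt; apply/orP; left; apply/eqP; ring.
Qed.

Let sqrt_p k : p k <= Num.sqrt (p k).
Proof.
rewrite -{1}[p k]ger0_norm // -sqrtr_sqr ler_wsqrtr // expr2.
by rewrite ler_piMl.
Qed.

(** The colours other than j are peeled one at a time. Keeping j to the end retains the factor sqrt
    p_j in every step, and the base case A = {j} is exact. *)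
Lemma mean_prod_sub j A : j \in A ->
  `|mean (F A) - \prod_(k in A) p k| <= (#|A|.-1)%:R * (n%:R * lambda * Num.sqrt (p j)).
Proof.
move: {2}#|A| (erefl #|A|) => m; elim: m A => [|m IH] A Am jA.
  by move/eqP: Am; rewrite cards_eq0 => /eqP A0; rewrite A0 inE in jA.
have nl0 : 0 <= n%:R * lambda by rewrite mulr_ge0 // ltW.
have [A1|[k]] := set_0Vmem (A :\ j).
  have {A1}-> : A = [set j] by rewrite -(setD1K jA) A1 setU0.
  have -> : mean (F [set j]) = p j.
    by congr (_ / _); apply: eq_bigr => s _; rewrite ffunE big_set1.
  by rewrite big_set1 subrr normr0 cards1 mul0r.
rewrite !inE => /andP[kj kA]; pose B := A :\ k.
have jB : j \in B by rewrite !inE eq_sym kj.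
have kB : k \notin B by rewrite !inE eqxx.
have AE : A = k |: B by rewrite setD1K.
have Bm : #|B| = m by move: Am; rewrite AE cardsU1 kB => -[].
rewrite AE big_setU1 //= cardsU1 kB /=.
have -> : mean (F (k |: B)) - p k * \prod_(i in B) p i =
    (mean (F (k |: B)) - p k * mean (F B)) + p k * (mean (F B) - \prod_(i in B) p i) by ring.
apply: le_trans (ler_normD _ _) _; rewrite normrM (ger0_norm (p_ge0 k)).
have m0 : (0 < m)%N by rewrite -Bm; apply/card_gt0P; exists j.
have -> : (#|B|)%:R = 1 + (#|B|.-1)%:R :> R by rewrite nat1r prednK // Bm.
rewrite mulrDl mul1r lerD //.
  apply: le_trans (peel kB jB) _; rewrite ler_wpM2l // ler_wsqrtr //.
  by rewrite ler_piMl.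
by apply: le_trans (IH B Bm jB); rewrite ler_piMl.
Qed.

(** Peeling i first costs n lambda sqrt(p_i p_j). The errors of the other n - 1 steps are multiplied
    by p_i <= sqrt p_i, which supplies the missing factor. *)
Theorem mixing i j : i != j ->
  `|mean (fun s => \prod_k f k s) - \prod_k p k|
    <= n%:R * n%:R * lambda * Num.sqrt (p i * p j).
Proof.
move=> ij; pose B := [set~ i].
have iB : i \notin B by rewrite !inE eqxx.
have jB : j \in B by rewrite !inE eq_sym.
have TE : [set: I] = i |: B by rewrite setUCr.
have Bn : #|B| = n by rewrite cardsC1.
have nl0 : 0 <= n%:R * lambda by rewrite mulr_ge0 // ltW.
have -> : mean (fun s => \prod_k f k s) = mean (F (i |: B)).
  by congr (_ / _); apply: eq_bigr => s _; rewrite -TE ffunE; apply: eq_bigl => k; rewrite inE.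
have -> : \prod_k p k = p i * \prod_(k in B) p k.
  by rewrite -big_setU1 // -TE; apply: eq_bigl => k; rewrite inE.
have -> : mean (F (i |: B)) - p i * \prod_(i in B) p i =
    (mean (F (i |: B)) - p i * mean (F B)) + p i * (mean (F B) - \prod_(i in B) p i) by ring.
apply: le_trans (ler_normD _ _) _; rewrite normrM (ger0_norm (p_ge0 i)).
have n0 : (0 < n)%N by rewrite -Bn; apply/card_gt0P; exists j.
have -> : n%:R * n%:R * lambda * Num.sqrt (p i * p j) =
  bound i j + (n.-1)%:R * (n%:R * lambda * (Num.sqrt (p i) * Num.sqrt (p j))).
  by rewrite /bound sqrtrM // -{1}(prednK n0) -nat1r; ring.
apply: lerD; first exact: peel.
apply: le_trans (ler_wpM2l (p_ge0 i) (mean_prod_sub jB)) _; rewrite Bn.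
rewrite mulrCA ler_wpM2l // mulrCA ler_wpM2l // ler_wpM2r ?sqrtr_ge0 //.
Qed.

End ExpanderMixing.
(** * Facets of a partite complex *)

Section PartiteComplex.
Variables (T : finType) (n : nat) (X : {set {set T}}) (S : 'I_n.+1 -> {set T}).
Hypotheses (Xcomplex : simplicial_complex X) (Xpure : pure n X) (Xpartite : partite X S).

Definition facet := {s : {set T} | s \in faces X n.+1}.
Implicit Types (s t : facet) (J : {set 'I_n.+1}).

(** A singleton by partiteness; using the intersection itself avoids choosing its vertex. *)
Definition coordinate (i : 'I_n.+1) s : {set T} := val s :&: S i.

Definition colour (v : T) : 'I_n.+1 := odflt ord0 [pick i | v \in S i].

Lemma mem_side v i : v \in S i -> colour v = i.
Proof.
case: Xpartite => hd _ _ vi; rewrite /colour; case: pickP => [j vj|/(_ i)] /=; last by rewrite vi.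
by apply: contraTeq vj => ji; rewrite (disjointFl (hd _ _ ji) vi).
Qed.

Lemma facet_side s v : v \in val s -> v \in S (colour v).
Proof.
case: Xpartite => _ hv _ vs.
have : v \in verts X.
  have [_ Xsub] := Xcomplex; have := valP s; rewrite !inE cards1 eqxx andbT => /andP[sX _].
  by apply: Xsub sX _; rewrite sub1set.
by rewrite hv => /bigcupP[i _ vi]; rewrite (mem_side vi).
Qed.

Lemma facet_vertex s i : exists2 v, v \in val s & colour v = i.
Proof.
case: Xpartite => _ _ /(_ _ (valP s) i) /eqP/cards1P[v hv].
have : v \in val s :&: S i by rewrite hv inE.
by rewrite inE => /andP[vs /mem_side vi]; exists v.
Qed.

Lemma colour_inj s : {in val s &, injective colour}.
Proof.
case: Xpartite => _ _ /(_ _ (valP s)) h1 u v us vs uv.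
have /eqP/cards1P[w hw] := h1 (colour v).
have : u \in val s :&: S (colour v) by rewrite inE us -uv (facet_side us).
have : v \in val s :&: S (colour v) by rewrite inE vs (facet_side vs).
by rewrite hw !inE => /eqP -> /eqP ->.
Qed.

Definition subface J s : {set T} := [set v in val s | colour v \in J].

(** Through this, conditioning on the colours in J becomes restriction to the link of the J-coloured
    face of s. *)
Lemma agree_subfaceP J s t : reflect (subface J s \subset val t) (agree coordinate J s t).
Proof.
apply: (iffP (agreeP _ _ _ _)) => [h|/subsetP h i iJ].
  apply/subsetP => v; rewrite inE => /andP[vs vJ].
  have := h _ vJ; rewrite /coordinate => /setP/(_ v).
  by rewrite !inE vs (facet_side vs) /= => /esym/andP[].
have [v vs vi] := facet_vertex s i.
have vt : v \in val t by apply: h; rewrite inE vs vi.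
have E (r : facet) : v \in val r -> coordinate i r = [set v].
  move=> vr; apply/setP => w; rewrite !inE; apply/andP/eqP => [[wr /mem_side wi]|->].
    by apply: (colour_inj wr vr); rewrite wi vi.
  by rewrite -vi (facet_side vr).
by rewrite !E.
Qed.

Lemma card_subface J s : #|subface J s| = #|J|.
Proof.
have JE : colour @: subface J s = J.
  apply/setP => i; apply/imsetP/idP => [[v]|iJ]; first by rewrite inE => /andP[_ vJ] ->.
  by have [v vs vi] := facet_vertex s i; exists v; rewrite // inE vs vi.
rewrite -[in RHS]JE card_in_imset // => u v; rewrite !inE => /andP[us _] /andP[vs _].
exact: colour_inj us vs.
Qed.

Lemma subface_mem J s : subface J s \in faces X #|J|.
Proof.
rewrite inE card_subface eqxx andbT; have [_ Xsub] := Xcomplex.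
have := valP s; rewrite inE => /andP[sX _]; apply: Xsub sX _.
by apply/subsetP => v; rewrite inE => /andP[].
Qed.

Lemma agree_subface J s t : agree coordinate J s t -> subface J s = subface J t.
Proof.
move=> st; apply/eqP; rewrite eqEcard !card_subface leqnn andbT.
apply/subsetP => v vs; have := vs; rewrite !inE => /andP[_ ->]; rewrite andbT.
exact: (subsetP (elimT (agree_subfaceP _ _ _) st)).
Qed.

Lemma agreeU1_mem J s t v : agree coordinate J s t -> v \in val s -> v \in val t ->
  agree coordinate (colour v |: J) s t.
Proof.
move=> /agree_subfaceP/subsetP st vs vt; apply/agree_subfaceP/subsetP => w.
rewrite !inE => /andP[ws /predU1P[wv|wJ]]; last by apply: st; rewrite inE ws.
by rewrite (colour_inj ws vs wv).
Qed.

Lemma facet_extend sigma : sigma \in X -> exists t, sigma \subset val t.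
Proof. by move=> /Xpure[t tF st]; exists (exist _ t tF). Qed.

Lemma link_vertsP J s v : reflect
  (exists t, [/\ agree coordinate J s t, v \in val t & colour v \notin J])
  (v \in verts (link X (subface J s))).
Proof.
have [_ Xsub] := Xcomplex.
apply: (iffP idP) => [|[t [st vt vJ]]].
  rewrite !inE => /andP[/andP[vX /andP[svX cv]] _].
  have [t svt] := facet_extend svX.
  have /subUsetP[st vt] := svt; exists t; split.
  - exact/agree_subfaceP.
  - by rewrite -sub1set.
  (* A vertex of colour in J would already lie in the subface, against the cardinality condition in
     [link]. *)
  apply/negP => vJ; have vs : v \in subface J t by rewrite inE vJ -sub1set vt.
  rewrite -(agree_subface (introT (agree_subfaceP _ _ _) st)) in vs.
  by move: cv; rewrite cards1 setUC cardsU1 vs; lia.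
have tX : val t \in X by have := valP t; rewrite inE => /andP[].
have vX : [set v] \in X by apply: Xsub tX _; rewrite sub1set.
have vs : v \notin subface J s by rewrite (agree_subface st) inE negb_and vJ orbT.
rewrite !inE vX cards1 eqxx andbT /= setUC cardsU1 vs addnC eqxx andbT.
apply: Xsub tX _; rewrite subUset sub1set vt; exact/agree_subfaceP.
Qed.

Lemma link_adjP J s u v : reflect
  (exists t, [/\ agree coordinate J s t, u \in val t, v \in val t, u != v &
     (colour u \notin J) && (colour v \notin J)])
  (adj (link X (subface J s)) u v).
Proof.
have [_ Xsub] := Xcomplex.
apply: (iffP idP) => [|[t [st ut vt uv /andP[uJ vJ]]]].
  rewrite /adj /= !inE => /andP[/andP[uvX /andP[suvX cuv]] c2].
  have [t] := facet_extend suvX.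
  rewrite subUset => /andP[/agree_subfaceP st]; rewrite subUset !sub1set => /andP[ut vt].
  exists t; split=> //; first by move: c2; rewrite cards2; case: (u != v).
  have dis w : w \in [set u; v] -> w \in val t -> colour w \notin J.
    move=> wuv wt; apply: contraTN cuv => wJ.
    have ws : w \in subface J s by rewrite (agree_subface st) inE wt.
    rewrite cardsU; have : (0 < #|subface J s :&: [set u; v]|)%N.
      by apply/card_gt0P; exists w; rewrite inE ws.
    move: (subset_leq_card (subsetIl (subface J s) [set u; v])).
    by move: #|_| #|_| #|_|; lia.
  by rewrite !dis // !inE eqxx ?orbT.
have tX : val t \in X by have := valP t; rewrite inE => /andP[].
have uvt : [set u; v] \subset val t by rewrite subUset !sub1set ut.
have uvX : [set u; v] \in X by apply: Xsub tX _.
have dis : subface J s :&: [set u; v] = set0.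
  apply/setP => w; rewrite (agree_subface st) !inE; apply/negP => /andP[/andP[_ wJ]].
  by move=> /orP[] /eqP wE; rewrite wE ?(negbTE uJ) ?(negbTE vJ) in wJ.
rewrite /adj /= !inE uvX cards2 uv andbT /= cardsU dis cards0 subn0 cards2 uv eqxx andbT.
by apply: Xsub tX _; rewrite subUset uvt andbT; apply/agree_subfaceP.
Qed.

(** By hypothesis f is constant on the facets above the subface that share a vertex of colour
    outside J. A path in the link from a vertex of s to one of t carries the value across, as
    consecutive vertices lie in a common facet. *)
Lemma facet_connected (R : realFieldType) J (f : {ffun facet -> R^o}) :
  connected_links n X -> (#|J| < n)%N ->
  (forall k, k \notin J -> avg coordinate (k |: J) f = f) -> avg coordinate J f = f.
Proof.
move=> hconn Jn hf; apply: avg_id => s t st.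
have step k s' t' : k \notin J -> agree coordinate (k |: J) s' t' -> f s' = f t'.
  by move=> /hf; exact: avg_fix_agree.
have [k kJ] : exists k, k \notin J.
  apply/existsP; rewrite -negb_forall; apply: contraTN Jn => /forallP h.
  rewrite -leqNgt (leq_trans (leqnSn n)) // -[X in (X <= _)%N]card_ord.
  exact/subset_leq_card/subsetP.
have [u us uk] := facet_vertex s k; have [v vt vk] := facet_vertex t k.
have uV : u \in verts (link X (subface J s)).
  by apply/link_vertsP; exists s; rewrite agree_refl uk.
have vV : v \in verts (link X (subface J s)) by apply/link_vertsP; exists t; rewrite vk.
have sX : subface J s \in X by have := subface_mem J s; rewrite inE => /andP[].
have := hconn _ sX; rewrite card_subface => /(_ Jn _ _ uV vV) /connectP[p].
suff H : forall w, colour w \notin J ->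
  (forall s', agree coordinate J s s' -> w \in val s' -> f s = f s') ->
  path (adj (link X (subface J s))) w p -> v = last w p -> f s = f t.
  move=> hp hl; apply: (H u) => //; first by rewrite uk.
  by move=> s' ss' us'; apply: (step _ _ _ _ (agreeU1_mem ss' us us')); rewrite uk.
elim: p => [|x p IH] w wJ hw /=; first by move=> _ vw; apply: hw; rewrite // -vw.
move=> /andP[/link_adjP[t' [st' wt' xt' _ /andP[_ xJ]]] hp] hl.
apply: IH hp hl => // s' ss' xs'; rewrite (hw t') //.
have t's' : agree coordinate J t' s'.
  by rewrite -(agree_eqr st').
exact: step xJ (agreeU1_mem t's' xt' xs').
Qed.

(** * Random walks on links of codimension two *)

Section LinkWalk.
Variables (J : {set 'I_n.+1}) (i j : 'I_n.+1).
Hypotheses (Jn : #|J|.+2 = n.+1) (iJ : i \notin J) (jJ : j \notin J) (ij : i != j).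

Lemma two_colours k : k \notin J -> k = i \/ k = j.
Proof.
move=> kJ; have [->|ki] := eqVneq k i; first by left.
have [->|kj] := eqVneq k j; first by right.
have := max_card (mem (k |: (i |: (j |: J)))).
by rewrite !cardsU1 !inE !negb_or ki kj ij kJ iJ jJ !add1n card_ord Jn ltnn.
Qed.

(* The neighbours of v in the link correspond to the facets through the subface
   and v, by adding the missing vertex of colour j. *)
Lemma link_walk_sum (R : realFieldType) s t
    (v : vertex (link X (subface J s))) (phi : vertex (link X (subface J s)) -> R)
    (h : facet -> R) :
  agree coordinate J s t -> val v \in val t -> colour (val v) = i ->
  (forall t' (u : vertex (link X (subface J s))), agree coordinate J s t' ->
     val u \in val t' -> colour (val u) = j -> h t' = phi u) ->
  \sum_(u | adj (link X (subface J s)) (val v) (val u)) phi u =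
  \sum_(t' | agree coordinate (i |: J) t t') h t'.
Proof.
set Y := link X _ => st vt vi hphi.
have agreeW t' : agree coordinate (i |: J) t t' -> agree coordinate J s t' /\ val v \in val t'.
  move=> tt'; rewrite (agree_eqr st); split; first exact: agree_sub (subsetUr _ _) tt'.
  have /subsetP := elimT (agree_subfaceP _ _ _) tt'; apply.
  by rewrite inE vt vi setU11.
have adjE (u : vertex Y) : adj Y (val v) (val u) ->
    colour (val u) = j /\ exists t', agree coordinate (i |: J) t t' && (val u \in val t').
  move=> /link_adjP[t' [st' vt' ut' vu /andP[_ uJ]]].
  have [ui|uj] := two_colours uJ.
    by move: vu; rewrite (colour_inj vt' ut') ?eqxx // vi ui.
  split=> //; exists t'; rewrite ut' andbT -vi.
  by apply: agreeU1_mem vt vt'; rewrite -(agree_eqr st).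
transitivity (\sum_(u : vertex Y | adj Y (val v) (val u))
    \sum_(t' | agree coordinate (i |: J) t t' && (val u \in val (t' : facet))) h t').
  apply: eq_bigr => u /adjE[uj [t' /andP[tt' ut']]].
  (* The facet is determined by u: its other vertices are v and those of colour in J. *)
  rewrite (big_pred1 t'); first by have [st' _] := agreeW _ tt'; rewrite (hphi _ u).
  move=> r; apply/andP/eqP => [[tr ur]|->] //.
  have [st' vt'] := agreeW _ tt'; have [sr vr] := agreeW _ tr.
  apply: val_inj; apply/eqP; rewrite eq_sym eqEcard.
  have card_facet (q : facet) : #|val q| = n.+1.
    by have := valP q; rewrite inE => /andP[_ /eqP].
  rewrite !card_facet leqnn andbT; apply/subsetP => w wt'.
  have [wJ|wJ] := boolP (colour w \in J).
    have /subsetP := elimT (agree_subfaceP _ _ _) (etrans (esym (agree_eqr st' r)) sr).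
    by apply; rewrite inE wt'.
  have [wi|wj] := two_colours wJ.
    by rewrite (colour_inj wt' vt') // wi vi.
  by rewrite (colour_inj wt' ut') // wj uj.
rewrite (exchange_big_dep (fun t' => agree coordinate (i |: J) t t')) /=; last first.
  by move=> u t' _ /andP[].
apply: eq_bigr => t' tt'; have [st' vt'] := agreeW _ tt'.
have [w wt' wj] := facet_vertex t' j.
have wY : w \in verts Y by apply/link_vertsP; exists t'; rewrite wj.
rewrite (big_pred1 (exist _ w wY : vertex Y)) // => u /=; rewrite tt' /=.
apply/andP/eqP => [[/adjE[uj _] ut']|->] /=.
  by apply: val_inj => /=; apply: (colour_inj ut' wt'); rewrite uj wj.
split=> //; apply/link_adjP; exists t'; split; rewrite ?vi ?wj ?iJ ?jJ //.
by apply: contraNneq ij => vw; rewrite -vi -wj; apply/eqP; congr colour.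
Qed.

End LinkWalk.

(** Put f on the link vertices of colour i and g on those of colour j. The walk from a vertex of
    colour i averages g over the facets through it, which is E_{J+i} g = r f, and symmetrically for
    j. The value f s keeps the glued function nonzero. *)
Lemma walk_eigenfunction (R : realType) J i j (r : R) (f g : {ffun facet -> R^o}) s :
  #|J|.+2 = n.+1 -> i \notin J -> j \notin J -> i != j ->
  oscillating coordinate J i f -> oscillating coordinate J j g ->
  avg coordinate (i |: J) g = r *: f -> avg coordinate (j |: J) f = r *: g ->
  f s != 0 -> r \in walk_spectrum R (link X (subface J s)).
Proof.
move=> Jn iJ jJ ij [fi _] [gj _] gf fg fs; set Y := link X _.
have ji : j != i by rewrite eq_sym.
(* Such a facet exists by [link_vertsP], and by [at_eq] the value read on it does not depend on the
   choice. *)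
pose facet_at (v : vertex Y) : facet :=
  odflt s [pick t : facet | agree coordinate J s t && (val v \in val t)].
have facet_atP v : agree coordinate J s (facet_at v) /\ val v \in val (facet_at v).
  rewrite /facet_at; case: pickP => [t /andP[] //|h].
  have /link_vertsP[t [st vt _]] := valP v; by have := h t; rewrite st vt.
have colP (v : vertex Y) : colour (val v) = i \/ colour (val v) = j.
  by have /link_vertsP[t [_ _ /(two_colours Jn iJ jJ ij)]] := valP v.
pose phi : {ffun vertex Y -> R^o} :=
  [ffun v => if colour (val v) == i then f (facet_at v) else g (facet_at v)].
have at_eq k (v : vertex Y) t (h : {ffun facet -> R^o}) : avg coordinate (k |: J) h = h ->
    agree coordinate J s t -> val v \in val t -> colour (val v) = k -> h t = h (facet_at v).
  move=> hk st vt vk; have [sv vv] := facet_atP v.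
  apply: (avg_fix_agree hk); rewrite -vk; apply: agreeU1_mem => //.
  by rewrite -(agree_eqr st).
have key a b (h h' : {ffun facet -> R^o}) (v : vertex Y) :
    a \notin J -> b \notin J -> a != b -> avg coordinate (b |: J) h' = h' ->
    avg coordinate (a |: J) h' = r *: h ->
    (forall u : vertex Y, colour (val u) = b -> phi u = h' (facet_at u)) ->
    colour (val v) = a -> walk phi v = r * h (facet_at v).
  move=> aJ bJ ab hb ha phib va; have [sv vv] := facet_atP v.
  have S1 := link_walk_sum Jn aJ bJ ab sv vv va.
  rewrite ffunE (S1 _ phi h'); last first.
    by move=> t' u st' ut' ub; rewrite phib //; exact: at_eq ub.
  have -> : (degree v)%:R = #|agree coordinate (a |: J) (facet_at v)|%:R :> R.
    rewrite /degree cardsE -!sum1_card !natr_sum.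
    transitivity (\sum_(u : vertex Y | adj Y (val v) (val u)) (1 : R)).
      by apply: eq_bigl.
    by rewrite (S1 _ (fun=> 1) (fun=> 1)).
  by have := congr1 (fun q : {ffun facet -> R^o} => q (facet_at v)) ha; rewrite !ffunE.
have walkE : walk phi = r *: phi.
  apply/ffunP => v; rewrite [RHS]ffunE; have [va|vb] := colP v.
    rewrite (key i j f g) // => [|u ub]; first by rewrite ffunE va eqxx.
    by rewrite ffunE ub (negbTE ji).
  rewrite (key j i g f) // => [|u ub]; first by rewrite ffunE vb (negbTE ji).
  by rewrite ffunE ub eqxx.
have [v vs vi] := facet_vertex s i.
have vY : v \in verts Y by apply/link_vertsP; exists s; rewrite agree_refl vi.
have phi0 : phi != 0.
  apply: contraNneq fs => /ffunP/(_ (exist _ v vY)).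
  by rewrite !ffunE /= vi eqxx -(at_eq i _ s) ?agree_refl // => ->.
rewrite inE /passmx.leigenvalue; apply: contraNneq phi0 => E0.
rewrite -memv0 -E0 memv_ker add_lfunE opp_lfunE scale_lfunE id_lfunE lfunE /=.
by rewrite walkE subrr.
Qed.

End PartiteComplex.

(** * The mixing estimate *)

Lemma min_lt_pairs_ge (R : realType) n (C x : R) (f : 'I_n.+1 -> 'I_n.+1 -> R) :
  (0 < n)%N -> (forall i j, i != j -> x <= C * f i j) -> x <= C * min_lt_pairs f.
Proof.
move=> n0 hf; apply: (big_ind (fun m => x <= C * m)) => [|a b|p /ltn_eqF p12].
(* The initial value [f ord0 ord_max] is at distinct indices because n > 0. *)
- by apply: hf; rewrite -val_eqE /= ltn_eqF.
- by move=> xa xb; rewrite minEle; case: ifP.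
- by apply: hf; rewrite -val_eqE /= p12.
Qed.

(** The term k = 0 is n (n + 1)^n (2^n - 1), already at least n^2; the other terms are
    nonnegative. *)
Lemma mixing_constant_ge (R : realType) n : (0 < n)%N ->
  n%:R * n%:R <= mixing_constant R n.
Proof.
case: n => // n _; rewrite /mixing_constant big_ord_recl /=.
set rest := (X in _ <= _ + X); suff rest0 : 0 <= rest.
  rewrite addn1 !subn0 subn1 /= add0n mul1r expr1n.
  apply: le_trans (_ : _ <= n.+1`!%:R * (n.+2 ^ n.+1)%:R / n`!%:R) _.
    rewrite factS natrM [_ * _ * _%:R]mulrAC mulfK ?pnatr_eq0 -?lt0n ?fact_gt0 //.
    rewrite ler_wpM2l // ler_nat expnS; apply: leq_trans (leqnSn _) _.
    by rewrite leq_pmulr // expn_gt0.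
  rewrite -[X in X <= _]addr0 lerD //; apply: ler_peMr; first by rewrite divr_ge0 ?mulr_ge0.
  by rewrite add0n -natrX lerBrDr -(natrD _ 1 1) ler_nat addn1 expnS leq_pmulr // expn_gt0.
apply: sumr_ge0 => k _; apply: mulr_ge0; first by rewrite divr_ge0 ?mulr_ge0.
rewrite subr_ge0 !addn1 exprS ler_wpM2l //; apply: lerXn2r; rewrite ?nnegrE // ler_nat; lia.
Qed.

(** Double counting of incidences. With A = S_k it evaluates the number of facets, with A = U_k the
    sum of the indicator; K cancels in the quotient |U_k| / |S_k|. *)
Lemma count_incidence (T : finType) (F : {set {set T}}) (A : {set T}) (K : nat) :
  (forall v, v \in A -> #|[set s in F | v \in s]| = K) ->
  (\sum_(s in F) #|s :&: A|)%N = (#|A| * K)%N.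
Proof.
move=> hK; under eq_bigr do rewrite -sum1_card.
rewrite (exchange_big_dep (mem A)) /=; last by move=> s v _; rewrite inE => /andP[].
rewrite -sum_nat_const; apply: eq_bigr => v vA; rewrite -(hK v vA) -sum1_card.
by apply: eq_bigl => s; rewrite !inE vA andbT.
Qed.

Lemma facet_spectral_bound (R : realType) (T : finType) n (X : {set {set T}})
    (S : 'I_n.+1 -> {set T}) (lambda : R) :
  (0 < n)%N -> simplicial_complex X -> pure n X -> connected_links n X ->
  partite X S -> 0 < lambda < 1 ->
  (forall tau, tau \in faces X (n - 1) ->
     forall a : R, a \in walk_spectrum R (link X tau) ->
       -1 <= a <= spectrum_bound n lambda \/ a = 1) ->
  forall J : {set 'I_n.+1}, (#|J| < n)%N ->
    correlation_bound (@coordinate _ _ X S) J lambda.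
Proof.
move=> n0 hX hpure hconn hS l01 hspec J Jn.
have connJ (K : {set 'I_n.+1}) (f : {ffun facet n X -> R^o}) : (#|K|.+1 < #|'I_n.+1|)%N ->
    (forall k, k \notin K -> avg (coordinate S) (k |: K) f = f) ->
    avg (coordinate S) K f = f.
  by rewrite card_ord ltnS => Kn; exact: facet_connected.
apply: (correlation_bound_all connJ l01) => [K|]; rewrite card_ord ?ltnS // => Kn.
have n1 : n%:R - 1 = #|K|%:R :> R.
  by apply/eqP; rewrite subr_eq natr1 eqr_nat eq_sym -eqSS Kn.
have Kn1 : (n - 1)%N = #|K| by lia.
rewrite -n1; apply: (correlation_bound_top connJ); first by rewrite card_ord; lia.
move=> i j r f g iK jK ij /andP[mr r1] fO gO gf fg.
have notspec (s : facet n X) : r \notin walk_spectrum R (link X (subface S K s)).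
  apply/negP => /hspec; rewrite Kn1 => /(_ (subface_mem hX hS K s)) [/andP[_]|rE].
    by rewrite leNgt mr.
  by rewrite rE ltxx in r1.
have ji : j != i by rewrite eq_sym.
split; apply/ffunP => s; rewrite [RHS]ffunE; apply/eqP.
  by apply: contraNT (notspec s); exact: (walk_eigenfunction hX hpure hS Kn iK jK ij fO gO gf fg).
by apply: contraNT (notspec s); exact: (walk_eigenfunction hX hpure hS Kn jK iK ji gO fO fg gf).
Qed.

Theorem corollary1p4 (R : realType) (T : finType) (n : nat)
    (X : {set {set T}}) (S : 'I_n.+1 -> {set T}) (lambda : R) :
  (1 <= n)%N ->
  simplicial_complex X ->
  pure n X ->
  connected_links n X ->
  partite X S ->
  partite_regular X S ->
  0 < lambda < 1 ->
  (forall tau, tau \in faces X (n - 1) ->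
     forall a : R, a \in walk_spectrum R (link X tau) ->
       -1 <= a <= spectrum_bound n lambda \/ a = 1) ->
  forall U : 'I_n.+1 -> {set T}, (forall i, U i \subset S i) ->
    `| #|transversal_faces X U|%:R / #|faces X n.+1|%:R
       - (\prod_i #|U i|%:R) / (\prod_i #|S i|%:R) |
    <= mixing_constant R n * lambda *
       min_lt_pairs (fun i j =>
         Num.sqrt ((#|U i|%:R * #|U j|%:R) / (#|S i|%:R * #|S j|%:R))).
Proof.
move=> n0 hX hpure hconn hS hreg l01 hspec U US.
have hcorr := facet_spectral_bound n0 hX hpure hconn hS l01 hspec.
have l0 : 0 < lambda by case/andP: l01.
pose F := faces X n.+1.
have card_facets : #|{: facet n X}| = #|F| by rewrite card_sig.
have F0 : (0 < #|F|)%N.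
  by apply/card_gt0P; case: hX => /hpure[t tF _] _; exists t.
have [_ _ hS1] := hS.
have cardU s k : s \in F -> #|s :&: U k| = 0%N \/ #|s :&: U k| = 1%N.
  move=> sF; have := subset_leq_card (setIS s (US k)); rewrite hS1 //.
  by case: #|_| => [|[]]; [left|right|].
(* This cardinality is 0 or 1 because U_k lies in S_k, so it is the indicator of x_k in U_k. *)
pose f k : {ffun facet n X -> R^o} := [ffun s => #|val s :&: U k|%:R].
have f01 k s : f k s = 0 \/ f k s = 1.
  by rewrite ffunE; have [->|->] := cardU _ k (valP s); [left|right].
have f_coord k : avg (coordinate S) [set k] (f k) = f k.
  apply: avg_id => s t /agreeP st; rewrite !ffunE.
  rewrite -(setIidPr (US k)) !setIA.
  by have := st k (set11 k); rewrite /coordinate => ->.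
have meanE (h : {set T} -> R) :
    mean (fun s : facet n X => h (val s)) = (\sum_(s in F) h s) / #|F|%:R.
  by rewrite /mean card_facets [in RHS]big_sub.
have p_E k : mean (f k) = #|U k|%:R / #|S k|%:R.
  have [K hK] := hreg k.
  have -> : mean (f k) = mean (fun s : facet n X => #|val s :&: U k|%:R).
    by congr (_ / _); apply: eq_bigr => s _; rewrite ffunE.
  have FE : #|F| = (#|S k| * K)%N.
    by rewrite -(count_incidence hK) -sum1_card; apply: eq_bigr => s /hS1 ->.
  rewrite (meanE (fun s => #|s :&: U k|%:R)) -natr_sum (count_incidence (K := K)).
    rewrite FE !natrM -mulf_div divff ?mulr1 //.
    by move: F0; rewrite FE muln_gt0 => /andP[_]; rewrite pnatr_eq0 -lt0n.
  by move=> v /(subsetP (US k)); exact: hK.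
(* A product of 0-1 factors is 1 exactly when s meets every U_k, so its mean counts the transversal
   facets. *)
have transE : mean (fun s => \prod_k f k s) = #|transversal_faces X U|%:R / #|F|%:R.
  have -> : mean (fun s => \prod_k f k s) =
      mean (fun s : facet n X => (\prod_k #|val s :&: U k|)%:R).
    congr (_ / _); apply: eq_bigr => s _; rewrite natr_prod.
    by apply: eq_bigr => k _; rewrite ffunE.
  rewrite (meanE (fun s => (\prod_k #|s :&: U k|)%:R)) -natr_sum; congr (_%:R / _).
  rewrite -sum1_card [RHS]big_mkcond [LHS]big_mkcond; apply: eq_bigr => s _.
  rewrite [s \in transversal_faces X U]inE -/F; case: ifP => //= sF.
  case: forallP => [h|h]; first by rewrite big1 // => k _; apply/eqP.
  apply/eqP/negPn/negP => p0; apply: h => k.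
  by have [E|->//] := cardU s k sF; rewrite (bigD1 k) //= E in p0.
rewrite -transE.
have -> : (\prod_i #|U i|%:R) / (\prod_i #|S i|%:R) = \prod_k mean (f k).
  by rewrite -prodf_div; apply: eq_bigr => k _; rewrite p_E.
apply: min_lt_pairs_ge => // i j ij.
have hcorr' (J : {set 'I_n.+1}) : (#|J|.+1 < #|'I_n.+1|)%N ->
    correlation_bound (@coordinate _ _ X S) J lambda.
  by rewrite card_ord ltnS; exact: hcorr.
apply: le_trans (mixing l0 hcorr' f01 f_coord ij) _.
rewrite card_ord /= !p_E mulf_div ler_wpM2r ?sqrtr_ge0 // ler_wpM2r ?(ltW l0) //.
exact: mixing_constant_ge.
Qed.
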